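(* Suppose that $A\subseteq\omega$ is a Turing incomplete c.e. set, let $B\subseteq\omega$, and let $\gamma$ be one of the numberings $W_{(-)} : n\mapsto W_n$ or $\varphi_{(-)} : n\mapsto\varphi_n$. Then $\mathrm{Skolem}(A,B,\gamma)$ holds if and only if $A\leq_T B$.
   Context: $\varphi_n$ is the $n$-th partial computable function and $W_n$ the $n$-th c.e. set ($W_n$ being the domain of $\varphi_n$) in the standard numberings. A numbering is a surjection $\gamma:\omega\to S$ onto a set $S$; write $n\sim_\gamma m$ iff $\gamma(n)=\gamma(m)$. $\mathrm{Skolem}(A,B,\gamma)$ means: for every (total) $A$-computable binary function $h:\omega^2\to\omega$ there is a (total) $B$-computable function $f:\omega\to\omega$ such that $h(n,f(n))\sim_\gamma f(n)$ for all $n\in\omega$. A c.e. set $A$ is incomplete if $\emptyset'\not\leq_T A$. *)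

(* Defs.v *)
From Stdlib Require Import Cantor.
From mathcomp Require Import all_boot all_classical.

Set Implicit Arguments.
Unset Strict Implicit.
Unset Printing Implicit Defensive.

Local Open Scope classical_set_scope.

(* Cantor's pairing bijection omega^2 -> omega, and its two projections. *)
Definition npair (x y : nat) : nat := Cantor.to_nat (x, y).
Definition nfst (n : nat) : nat := (Cantor.of_nat n).1.
Definition nsnd (n : nat) : nat := (Cantor.of_nat n).2.

Lemma nfst_pair x y : nfst (npair x y) = x.
Proof. by rewrite /nfst /npair Cantor.cancel_of_to. Qed.

Lemma nsnd_pair x y : nsnd (npair x y) = y.
Proof. by rewrite /nsnd /npair Cantor.cancel_of_to. Qed.

Lemma npair_eta n : npair (nfst n) (nsnd n) = n.
Proof. by rewrite /npair /nfst /nsnd -surjective_pairing Cantor.cancel_to_of. Qed.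

Lemma leq_npair x y : y + x <= npair x y.
Proof. exact/leP/Cantor.to_nat_non_decreasing. Qed.

(* Kleene's partial recursive functions with an oracle, presented as unary
   functions; functions of several arguments are coded through npair. *)
Inductive code : Type :=
| Zero | Succ | Fst | Snd | Oracle
| Pair of code & code
| Comp of code & code
| Prec of code & code
| Mu of code.

Definition char (A : set nat) (x : nat) : nat := (x \in A).

Fixpoint prec_graph (f g : nat -> nat -> Prop) (a n : nat) : nat -> Prop :=
  if n is m.+1 then
    fun y => exists2 z, prec_graph f g a m z & g (npair a (npair m z)) y
  else f a.

(* eval A c x y : the program c with oracle A converges on input x, with
   output y. *)
Fixpoint eval (A : set nat) (c : code) (x y : nat) {struct c} : Prop :=
  match c with
  | Zero => y = 0
  | Succ => y = x.+1
  | Fst => y = nfst x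
  | Snd => y = nsnd x
  | Oracle => y = char A x
  | Pair c d => exists u v, [/\ eval A c x u, eval A d x v & y = npair u v]
  | Comp c d => exists2 z, eval A d x z & eval A c z y
  | Prec c d => prec_graph (eval A c) (eval A d) (nfst x) (nsnd x) y
  | Mu c => eval A c (npair x y) 0 /\
            forall i, i < y -> exists z, eval A c (npair x i) z.+1
  end.

Lemma eval_functional A c x y y' : eval A c x y -> eval A c x y' -> y = y'.
Proof.
elim: c x y y' => [||||| c IHc d IHd | c IHc d IHd | c IHc d IHd | c IHc] x y y'
  /=; try by move=> -> ->.
- move=> [u [v [cu dv ->]]] [u' [v' [cu' dv' ->]]].
  by rewrite (IHc _ _ _ cu cu') (IHd _ _ _ dv dv').
- move=> [z dz cy] [z' dz' cy']; rewrite -(IHd _ _ _ dz dz') in cy'.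
  exact: IHc cy cy'.
- elim: (nsnd x) y y' => [|n IHn] y y' /=; first exact: IHc.
  move=> [z pz dy] [z' pz' dy']; rewrite -(IHn _ _ pz pz') in dy'.
  exact: IHd dy dy'.
- move=> [c0 clt] [c0' clt']; case: (ltngtP y y') => // [lt|lt].
  + by have [z cz] := clt' _ lt; have := IHc _ _ _ cz c0.
  + by have [z cz] := clt _ lt; have := IHc _ _ _ cz c0'.
Qed.

Fixpoint encode (c : code) : nat :=
  match c with
  | Zero => npair 0 0
  | Succ => npair 1 0
  | Fst => npair 2 0
  | Snd => npair 3 0
  | Oracle => npair 4 0
  | Pair c d => npair 5 (npair (encode c) (encode d))
  | Comp c d => npair 6 (npair (encode c) (encode d))
  | Prec c d => npair 7 (npair (encode c) (encode d))
  | Mu c => npair 8 (encode c)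
  end.

(* The immediate subcodes of n have numbers smaller than n, so k > n is enough
   fuel; numbers with an unused tag are read as the program Zero. *)
Fixpoint decode_fuel (k n : nat) : code :=
  if k is k'.+1 then
    let m := nsnd n in
    match nfst n with
    | 0 => Zero
    | 1 => Succ
    | 2 => Fst
    | 3 => Snd
    | 4 => Oracle
    | 5 => Pair (decode_fuel k' (nfst m)) (decode_fuel k' (nsnd m))
    | 6 => Comp (decode_fuel k' (nfst m)) (decode_fuel k' (nsnd m))
    | 7 => Prec (decode_fuel k' (nfst m)) (decode_fuel k' (nsnd m))
    | 8 => Mu (decode_fuel k' m)
    | _ => Zero
    end
  else Zero.

Definition decode (n : nat) : code := decode_fuel n.+1 n.

Lemma encodeK : cancel encode decode.
Proof.
have pr t m k : npair t.+1 m <= k -> m < k.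
  by apply: leq_trans; apply: leq_trans (leq_npair _ _); rewrite addnS ltnS leq_addr.
have pl u v k : npair u v < k -> u < k.
  by apply: leq_ltn_trans; apply: leq_trans (leq_npair _ _); rewrite leq_addl.
have pv u v k : npair u v < k -> v < k.
  by apply: leq_ltn_trans; apply: leq_trans (leq_npair _ _); rewrite leq_addr.
suff H c k : encode c < k -> decode_fuel k (encode c) = c by move=> c; exact: H.
elim: c k => [||||| c IHc d IHd | c IHc d IHd | c IHc d IHd | c IHc] [|k] //;
  rewrite [encode _]/= ltnS => /pr lt; rewrite [decode_fuel _ _]/=;
  rewrite !(nfst_pair, nsnd_pair) //.
- by rewrite (IHc _ (pl _ _ _ lt)) (IHd _ (pv _ _ _ lt)).
- by rewrite (IHc _ (pl _ _ _ lt)) (IHd _ (pv _ _ _ lt)).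
- by rewrite (IHc _ (pl _ _ _ lt)) (IHd _ (pv _ _ _ lt)).
- by rewrite (IHc _ lt).
Qed.

(* The n-th partial computable function, as its graph: phi n x y means that
   phi_n(x) converges to y. Partial computable is computable with oracle the
   empty set. *)
Definition phi (n : nat) : nat -> nat -> Prop := eval set0 (decode n).

Definition W (n : nat) : set nat := [set x | exists y, phi n x y].

Lemma phi_encode c : phi (encode c) = eval set0 c.
Proof. by rewrite /phi encodeK. Qed.

Definition ce (A : set nat) : Prop := exists n, A = W n.

Definition computable_in (A : set nat) (f : nat -> nat) : Prop :=
  exists c, forall x, eval A c x (f x).

Definition computable2_in (A : set nat) (h : nat -> nat -> nat) : Prop :=
  exists c, forall x y, eval A c (npair x y) (h x y).

Definition turing_le (A B : set nat) : Prop := computable_in B (char A).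

(* The halting problem, {n | phi_n(n) converges}. *)
Definition zero_jump : set nat := [set n | W n n].

Definition incomplete (A : set nat) : Prop := ~ turing_le zero_jump A.

(* A map gamma : nat -> S is regarded as a numbering of its range. *)
Definition numbering_equiv (S : Type) (gamma : nat -> S) (n m : nat) : Prop :=
  gamma n = gamma m.

Definition Skolem (A B : set nat) (S : Type) (gamma : nat -> S) : Prop :=
  forall h : nat -> nat -> nat, computable2_in A h ->
  exists2 f : nat -> nat, computable_in B f &
    forall n, numbering_equiv gamma (h n (f n)) (f n).

(* Main.v *)
Require Import Defs.
From mathcomp Require Import all_boot all_classical zify.

(** Both numberings are handled at once: equality of partial functions implies
    equality of their domains, so the right-to-left direction is proved for
    [phi] and the left-to-right one for [W].

    If Skolem(A, B, gamma) holds, apply it to the function [h n x] equal to [a]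
    for [n] in [A] and to [b] otherwise, where [W a] is the singleton of 0 and
    [W b] its complement. Then [W (f n)] contains 0 or contains 1, according to
    whether [n] is in [A], and waiting for [phi (f n)] to halt on one of these
    two arguments decides [A] from [f], hence from [B]
    ([skolem_turing_le]).

    For the converse it is enough to find an [A]-computable Skolem function,
    since relative computability is transitive. This is the completeness
    criterion of Arslanov, with a parameter [n] carried along ([arslanov]).
    As [A] is c.e., [h] is the limit of a computable [hh] and has an
    [A]-computable modulus ([limit_lemma]). The recursion theorem provides
    programs [g n k] that wait until [k] enters the halting problem, say at
    stage [s], and then imitate [hh n (g n k) s] ([delayed_fixpoint]). Any [k]
    that enters at a stage where [hh] has reached its limit makes [g n k] a
    fixed point of [h n], and [A] can recognise such a [k], because [h] itself
    is [A]-computable. If for some [n] there were none, each [k] in the halting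
    problem would enter before the modulus at [g n k], which would make the
    halting problem computable in [A].

    The construction rests on a universal program. It is obtained from a stack
    machine whose configurations are numbers and whose step function is
    primitive recursive; its bounded runs also supply the stages used above. *)

Set Implicit Arguments.
Unset Strict Implicit.
Unset Printing Implicit Defensive.

Arguments npair : simpl never.
Arguments nfst : simpl never.
Arguments nsnd : simpl never.

(** * Relative computability *)

Definition code_id : code := Pair Fst Snd.

Lemma eval_id A x : eval A code_id x x.
Proof. by exists (nfst x), (nsnd x); rewrite npair_eta. Qed.

Lemma eval_comp A c d x z y :
  eval A d x z -> eval A (Comp c d) x y <-> eval A c z y.
Proof.
move=> dz; split=> [[z' dz' cy]|cy]; last by exists z.
by rewrite (eval_functional dz dz').
Qed.

Lemma eval_pair A c d x u v :
  eval A c x u -> eval A d x v -> eval A (Pair c d) x (npair u v).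
Proof. by exists u, v. Qed.

Lemma eval_prec A c d x y :
  eval A (Prec c d) x y =
  prec_graph (eval A c) (eval A d) (nfst x) (nsnd x) y.
Proof. by []. Qed.

Lemma prec_graph_ext (f f' g g' : nat -> nat -> Prop) a n y :
  (forall x z, f x z <-> f' x z) -> (forall x z, g x z <-> g' x z) ->
  prec_graph f g a n y <-> prec_graph f' g' a n y.
Proof.
move=> ff gg; elim: n y => [|n IHn] y /=; first exact: ff.
by split=> -[z /IHn pz /gg gz]; exists z.
Qed.

(** Turing reductions compose because queries to the oracle of [c] can be
    answered by running [d]. *)
Fixpoint relativize (d c : code) : code :=
  match c with
  | Oracle => d
  | Pair c1 c2 => Pair (relativize d c1) (relativize d c2)
  | Comp c1 c2 => Comp (relativize d c1) (relativize d c2)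
  | Prec c1 c2 => Prec (relativize d c1) (relativize d c2)
  | Mu c1 => Mu (relativize d c1)
  | _ => c
  end.

Lemma eval_relativize A B d : (forall x, eval B d x (char A x)) ->
  forall c x y, eval A c x y <-> eval B (relativize d c) x y.
Proof.
move=> dA; elim=> [||||| c1 IH1 c2 IH2 | c1 IH1 c2 IH2 | c1 IH1 c2 IH2 | c IH] //= x y.
- split=> [->//|dxy]; exact: eval_functional dxy (dA x).
- by split=> -[u [v [/IH1 e1 /IH2 e2 ->]]]; exists u, v.
- by split=> -[z /IH2 e2 /IH1 e1]; exists z.
- exact: prec_graph_ext.
- split=> -[/IH e0 lt]; split=> // i /lt [z /IH]; by exists z.
Qed.

Lemma computable_in_trans A B f :
  turing_le A B -> computable_in A f -> computable_in B f.
Proof.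
move=> [d dA] [c cf]; exists (relativize d c) => x.
exact/(eval_relativize dA).
Qed.

Lemma char0 x : char set0 x = 0.
Proof. by rewrite /char in_set0. Qed.

Lemma computable_in0 A f : computable_in set0 f -> computable_in A f.
Proof.
by apply: computable_in_trans; exists Zero => x; rewrite char0.
Qed.

(** * Closure properties of the total computable functions *)

Section Closure.

Variable A : set nat.
Local Notation computable := (computable_in A).
Implicit Types (f g k : nat -> nat) (p q : nat -> bool).

Lemma computable_ext f g : f =1 g -> computable f -> computable g.
Proof. by move=> fg [c cf]; exists c => x; rewrite -fg. Qed.

Lemma computable_id : computable (fun x => x).
Proof. by exists code_id => x; apply: eval_id. Qed.

Lemma computable_comp f g :
  computable f -> computable g -> computable (fun x => f (g x)).
Proof. by move=> [c cf] [d dg]; exists (Comp c d) => x; exists (g x). Qed.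

Lemma computable_char f : computable f -> computable (fun x => char A (f x)).
Proof. by apply: computable_comp; exists Oracle. Qed.

Lemma computable_fst f : computable f -> computable (fun x => nfst (f x)).
Proof. by apply: computable_comp; exists Fst. Qed.

Lemma computable_snd f : computable f -> computable (fun x => nsnd (f x)).
Proof. by apply: computable_comp; exists Snd. Qed.

Lemma computable_succ f : computable f -> computable (fun x => (f x).+1).
Proof. by apply: computable_comp; exists Succ. Qed.

Lemma computable_pair f g :
  computable f -> computable g -> computable (fun x => npair (f x) (g x)).
Proof.
by move=> [c cf] [d dg]; exists (Pair c d) => x; exists (f x), (g x).
Qed.

Lemma computable_const n : computable (fun=> n).
Proof.
elim: n => [|n]; first by exists Zero.
exact: computable_succ.
Qed.

(** The first argument of [g] carries the value of [x] through the recursion. *)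
Lemma computable_iteri (g : nat -> nat -> nat -> nat) k f :
  computable (fun w => g (nfst w) (nfst (nsnd w)) (nsnd (nsnd w))) ->
  computable k -> computable f ->
  computable (fun x => iteri (k x) (g x) (f x)).
Proof.
move=> [d dg] kP [c cf].
have recP : computable (fun w => iteri (nsnd w) (g (nfst w)) (f (nfst w))).
  exists (Prec c d) => w /=; elim: (nsnd w) => [|n IHn] /=; first exact: cf.
  exists (iteri n (g (nfst w)) (f (nfst w))) => //.
  by have := dg (npair (nfst w) (npair n (iteri n (g (nfst w)) (f (nfst w)))));
    rewrite !(nfst_pair, nsnd_pair).
apply: computable_ext (computable_comp recP (computable_pair computable_id kP)).
by move=> x /=; rewrite nfst_pair nsnd_pair.
Qed.

Lemma computable_iter (g : nat -> nat -> nat) k f :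
  computable (fun w => g (nfst w) (nsnd w)) ->
  computable k -> computable f ->
  computable (fun x => iter (k x) (g x) (f x)).
Proof.
move=> gP kP fP.
apply: computable_ext (computable_iteri (g := fun x _ => g x) _ kP fP).
  by move=> x; elim: (k x) => //= n ->.
have hP : computable (fun w => npair (nfst w) (nsnd (nsnd w))).
  apply: computable_pair; [exact: (computable_fst computable_id)|].
  exact: (computable_snd (computable_snd computable_id)).
apply: computable_ext (computable_comp gP hP) => w.
by rewrite nfst_pair nsnd_pair.
Qed.

Lemma computable_if p f g :
  computable (fun x => p x) -> computable f -> computable g ->
  computable (fun x => if p x then f x else g x).
Proof.
move=> pP fP gP.
apply: computable_ext (computable_iteri (g := fun x _ _ => f x) _ pP gP).
  by move=> x; case: (p x).
exact: computable_comp fP (computable_fst computable_id).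
Qed.

Lemma computable_negb p :
  computable (fun x => p x) -> computable (fun x => ~~ p x).
Proof.
move=> pP; apply: computable_ext
  (computable_if pP (computable_const 0) (computable_const 1)).
by move=> x; case: (p x).
Qed.

Lemma computable_andb p q : computable (fun x => p x) ->
  computable (fun x => q x) -> computable (fun x => p x && q x).
Proof.
move=> pP qP; apply: computable_ext (computable_if pP qP (computable_const 0)).
by move=> x; case: (p x).
Qed.

Lemma computable_pred f : computable f -> computable (fun x => (f x).-1).
Proof.
move=> fP; apply: computable_ext
  (computable_iteri (g := fun _ m _ => m) _ fP (computable_const 0)).
  by move=> x; case: (f x).
exact: (computable_fst (computable_snd computable_id)).
Qed.

Lemma computable_add f g :
  computable f -> computable g -> computable (fun x => f x + g x).
Proof.
move=> fP gP; apply: computable_ext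
  (computable_iter (g := fun _ => succn) _ gP fP).
  by move=> x; elim: (g x) => [|n IHn] /=; rewrite ?addn0 // IHn addnS.
exact: (computable_succ (computable_snd computable_id)).
Qed.

Lemma computable_sub f g :
  computable f -> computable g -> computable (fun x => f x - g x).
Proof.
move=> fP gP; apply: computable_ext
  (computable_iter (g := fun _ => predn) _ gP fP).
  by move=> x; elim: (g x) => [|n IHn] /=; rewrite ?subn0 // IHn subnS.
exact: (computable_pred (computable_snd computable_id)).
Qed.

Lemma computable_max f g :
  computable f -> computable g -> computable (fun x => maxn (f x) (g x)).
Proof.
move=> fP gP.
apply: computable_ext (computable_add fP (computable_sub gP fP)) => x.
by rewrite maxnE.
Qed.

Lemma computable_eq0 f : computable f -> computable (fun x => f x == 0).
Proof.
move=> fP; apply: computable_ext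
  (computable_sub (computable_const 1) fP) => x.
by case: (f x) => // n; rewrite subSS sub0n.
Qed.

Lemma computable_eq f g :
  computable f -> computable g -> computable (fun x => f x == g x).
Proof.
move=> fP gP; have := computable_eq0 (computable_add (computable_sub fP gP)
  (computable_sub gP fP)).
by apply: computable_ext => x; rewrite addn_eq0 !subn_eq0 -eqn_leq.
Qed.

(** Boolean functions are coded by 0 and 1, so the minimisation operator, which
    looks for a zero, is run on the negation of [q]. *)
Lemma computable_search q : computable (fun w => q w) ->
  (forall x, exists s, q (npair x s)) ->
  exists2 g, computable g & forall x, q (npair x (g x)).
Proof.
move=> /computable_negb[c cq] qs; exists (fun x => ex_minn (qs x)).
  exists (Mu c) => x /=; case: ex_minnP => s qxs mins; split.
    by have := cq (npair x s); rewrite qxs.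
  move=> i lt_is; exists 0; have := cq (npair x i).
  case: (boolP (q _)) => // /mins; by rewrite leqNgt lt_is.
by move=> x; case: ex_minnP.
Qed.

End Closure.

(** Computability is proved by following the syntax of the defining expression;
    the extension receives the functions introduced later. *)
Ltac computability_extension := fail.

Ltac computability :=
  lazymatch goal with
  | |- computable_in _ (fun x => x) => exact: computable_id
  | |- computable_in _ (fun _ => ?n) => exact: computable_const
  | |- computable_in _ (fun x => npair _ _) =>
      apply: computable_pair; computability
  | |- computable_in _ (fun x => nfst _) => apply: computable_fst; computability
  | |- computable_in _ (fun x => nsnd _) => apply: computable_snd; computability
  | |- computable_in _ (fun x => S _) => apply: computable_succ; computability
  | |- computable_in _ (fun x => predn _) =>
      apply: computable_pred; computability
  | |- computable_in _ (fun x => maxn _ _) =>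
      apply: computable_max; computability
  | |- computable_in _ (fun x => char _ _) =>
      apply: computable_char; computability
  | |- computable_in _ (fun x => if _ then _ else _) =>
      apply: computable_if; computability
  | |- computable_in _ (fun x => nat_of_bool (~~ _)) =>
      apply: computable_negb; computability
  | |- computable_in _ (fun x => nat_of_bool (_ && _)) =>
      apply: computable_andb; computability
  | |- computable_in _ (fun x => nat_of_bool (_ == _)) =>
      apply: computable_eq; computability
  | |- computable_in _ (fun x => iter _ _ _) =>
      apply: computable_iter; computability
  | |- computable_in ?A (npair ?n) =>
      change (computable_in A (fun x => npair n x)); computability
  | |- computable_in _ nfst =>
      exact: (computable_fst (computable_id _))
  | |- computable_in _ nsnd =>
      exact: (computable_snd (computable_id _))
  | |- _ => first [assumption | computability_extension | match goal with
      H : computable_in ?A ?F |- computable_in ?A (fun x => ?F _) =>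
        apply: (computable_comp H); computability end | idtac]
  end.

(** * A stack machine for partial computable functions *)

(** A configuration is a stack [K] with either a value [y] to be returned to it
    or a program [e] to be run on [x]. The empty stack is 0, and a stack [push]
    is a successor. Programs are kept as numbers, so that the machine accepts
    every index and not only those in the range of [encode]. *)
Definition ret (y K : nat) : nat := npair K (npair 0 y).
Definition run (e x K : nat) : nat := npair K (npair 1 (npair e x)).
Definition push (t p q K : nat) : nat := (npair (npair t (npair p q)) K).+1.

(** The tags tested are those of [encode]. The oracle, being empty, answers 0,
    as do the program [Zero] and the indices that code no program. *)
Definition step_run (e x K : nat) : nat :=
  let t := nfst e in let c := nfst (nsnd e) in let d := nsnd (nsnd e) in
  if t == 1 then ret x.+1 K
  else if t == 2 then ret (nfst x) K
  else if t == 3 then ret (nsnd x) K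
  else if t == 5 then run c x (push 0 d x K)
  else if t == 6 then run d x (push 2 c 0 K)
  else if t == 7 then
    if nsnd x == 0 then run c (nfst x) K
    else let am := npair (nfst x) (nsnd x).-1 in run e am (push 3 d am K)
  else if t == 8 then
    let xi := npair x 0 in run (nsnd e) xi (push 4 (nsnd e) xi K)
  else ret 0 K.

(** The tag [t] of the top frame says what was waiting for the value [y]:
    - 0: a pairing whose second component is the program [p] on input [q];
    - 1: a pairing whose first component is [p];
    - 2: a composition with outer program [p];
    - 3: a primitive recursion with step program [p], where [q] is the pair of
      the parameter and the last recursion index;
    - 4: a minimisation over [p], where [q] is the pair of the input and the
      candidate just tested. *)
Definition step_ret (y t p q K : nat) : nat :=
  if t == 0 then run p q (push 1 y 0 K)
  else if t == 1 then ret (npair p y) K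
  else if t == 2 then run p y K
  else if t == 3 then run p (npair (nfst q) (npair (nsnd q) y)) K
  else if y == 0 then ret (nsnd q) K
  else let xi := npair (nfst q) (nsnd q).+1 in run p xi (push 4 p xi K).

Definition step (st : nat) : nat :=
  let K := nfst st in let v := nsnd (nsnd st) in
  if nfst (nsnd st) == 0 then
    if K == 0 then st
    else let F := nfst K.-1 in
      step_ret v (nfst F) (nfst (nsnd F)) (nsnd (nsnd F)) (nsnd K.-1)
  else step_run (nfst v) (nsnd v) K.

Lemma computable_step A f :
  computable_in A f -> computable_in A (fun x => step (f x)).
Proof.
apply: computable_comp.
rewrite /step /step_run /step_ret /push /ret /run; cbv zeta.
computability.
Qed.

Lemma step_runE e x K : step (run e x K) = step_run e x K.
Proof. by rewrite /step /run !(nfst_pair, nsnd_pair). Qed.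

Lemma step_ret0 y : step (ret y 0) = ret y 0.
Proof. by rewrite /step /ret !(nfst_pair, nsnd_pair). Qed.

Lemma step_retE y t p q K : step (ret y (push t p q K)) = step_ret y t p q K.
Proof. by rewrite /step /ret /push !(nfst_pair, nsnd_pair). Qed.

Lemma nfst_leq n : nfst n <= n.
Proof. by rewrite -{2}[n]npair_eta (leq_trans _ (leq_npair _ _)) ?leq_addl. Qed.

Lemma nsnd_leq n : nsnd n <= n.
Proof. by rewrite -{2}[n]npair_eta (leq_trans _ (leq_npair _ _)) ?leq_addr. Qed.

Lemma nsnd_ltn e : 4 < nfst e -> nsnd e < e.
Proof.
move=> lt4; rewrite -[X in _ < X]npair_eta.
apply: leq_trans (leq_npair _ _); rewrite -addn1 leq_add2l.
exact: leq_trans lt4.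
Qed.

(** Subprograms have smaller numbers, so any sufficient fuel gives the same
    program. *)
Lemma decode_fuelE k n : n < k -> decode_fuel k n = decode n.
Proof.
rewrite /decode; move: (ltnSn n); move: {2 4}n.+1 => k' lt' lt.
elim: k k' n lt lt' => // k IHk [|k'] n //; rewrite !ltnS => le le' /=.
have IH u : 4 < nfst n -> u <= nsnd n -> decode_fuel k u = decode_fuel k' u.
  move=> /nsnd_ltn lt /leq_ltn_trans/(_ lt) lt_u.
  by apply: IHk; apply: leq_trans lt_u _.
move: IH; case: (nfst n) => [|[|[|[|[|[|[|[|[|?]]]]]]]]] // IH;
  by rewrite ?(IH _ isT (nfst_leq _)) ?(IH _ isT (nsnd_leq _)) ?(IH _ isT (leqnn _)).
Qed.

Definition opl (e : nat) := nfst (nsnd e).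
Definition opr (e : nat) := nsnd (nsnd e).

Lemma opl_ltn e : 4 < nfst e -> opl e < e.
Proof. by move=> /nsnd_ltn; apply: leq_ltn_trans (nfst_leq _). Qed.

Lemma opr_ltn e : 4 < nfst e -> opr e < e.
Proof. by move=> /nsnd_ltn; apply: leq_ltn_trans (nsnd_leq _). Qed.

Lemma phiE e : phi e =
  match nfst e with
  | 1 => fun x y => y = x.+1
  | 2 => fun x y => y = nfst x
  | 3 => fun x y => y = nsnd x
  | 5 => fun x y =>
      exists u v, [/\ phi (opl e) x u, phi (opr e) x v & y = npair u v]
  | 6 => fun x y => exists2 z, phi (opr e) x z & phi (opl e) z y
  | 7 => fun x => prec_graph (phi (opl e)) (phi (opr e)) (nfst x) (nsnd x)
  | 8 => fun x y => phi (nsnd e) (npair x y) 0 /\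
           forall i, i < y -> exists z, phi (nsnd e) (npair x i) z.+1
  | _ => fun x y => y = 0
  end.
Proof.
rewrite {1}/phi {1}/decode /=.
have sub u : 4 < nfst e -> u <= nsnd e -> decode_fuel e u = decode u.
  move=> /nsnd_ltn lt /leq_ltn_trans/(_ lt); exact: decode_fuelE.
move: sub; case: (nfst e) => [|[|[|[|[|[|[|[|[|?]]]]]]]]] // sub;
  rewrite ?(sub _ isT (nfst_leq _)) ?(sub _ isT (nsnd_leq _))
          ?(sub _ isT (leqnn _)) //=.
by apply/funext => x; apply/funext => y; rewrite char0.
Qed.

Lemma iter_final y s : iter s step (ret y 0) = ret y 0.
Proof. by elim: s => //= s ->; apply: step_ret0. Qed.

Lemma ret_inj y y' K K' : ret y K = ret y' K' -> y = y'.
Proof.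
by move=> /(congr1 (fun n => nsnd (nsnd n))); rewrite /ret !nsnd_pair.
Qed.

Lemma run_neq_ret e x K y K' : run e x K <> ret y K'.
Proof.
move=> /(congr1 (fun n => nfst (nsnd n))).
by rewrite /ret /run !(nfst_pair, nsnd_pair).
Qed.

Lemma push_neq0 y t p q K r : ret y (push t p q K) <> ret r 0.
Proof. by move=> /(congr1 nfst); rewrite /ret !nfst_pair. Qed.

Definition halts (st r : nat) := exists s, iter s step st = ret r 0.

Lemma halts_step st r : halts (step st) r -> halts st r.
Proof. by move=> [s st_s]; exists s.+1; rewrite iterSr. Qed.

(** Induction on the index [e], whose subprograms have smaller indices. Primitive
    recursion and minimisation run the same subprograms repeatedly, which takes
    an inner induction on the number of repetitions. *)
Lemma run_complete e x y K r :
  phi e x y -> halts (ret y K) r -> halts (run e x K) r.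
Proof.
elim/ltn_ind: e x y K => e IH x y K.
rewrite phiE => + yK; move=> ev; apply: halts_step; move: ev.
rewrite step_runE /step_run -!/(opl e) -!/(opr e).
have IHl := IH _ (opl_ltn _); have IHr := IH _ (opr_ltn _).
have IHs := IH _ (nsnd_ltn _).
case E: (nfst e) IHl IHr IHs => [|[|[|[|[|[|[|[|[|?]]]]]]]]] //= IHl IHr IHs;
  try by move=> ey; rewrite -ey.
- move=> [u [v [eu ev ey]]].
  apply: IHl eu _ => //; apply: halts_step; rewrite step_retE /step_ret /=.
  apply: IHr ev _ => //; apply: halts_step; rewrite step_retE /step_ret /=.
  by rewrite -ey.
- move=> [z ez ey].
  apply: IHr ez _ => //; apply: halts_step; rewrite step_retE /step_ret /=.
  exact: IHl ey yK.
- case: (nsnd x) y K yK => [|n] y K yK /=; first by move=> /IHl; apply.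
  move=> [z pz ey].
  have {ey}: halts (ret z (push 3 (opr e) (npair (nfst x) n) K)) r.
    apply: halts_step; rewrite step_retE /step_ret /=.
    by rewrite nfst_pair nsnd_pair; apply: IHr ey yK.
  elim: n z (push _ _ _ _) pz => [|n IHn] z {y yK}K pz zK; apply: halts_step;
    rewrite step_runE /step_run E /= nfst_pair nsnd_pair /=.
    exact: IHl pz zK.
  move: pz => [z' pz' ez]; apply: (IHn z') => //.
  apply: halts_step; rewrite step_retE /step_ret /=.
  by rewrite nfst_pair nsnd_pair; apply: IHr ez zK.
- move=> [e0 lt_y].
  (* The run is reconstructed backwards, from the successful candidate [y]. *)
  have: forall j, j <= y ->
    halts (run (nsnd e) (npair x (y - j))
             (push 4 (nsnd e) (npair x (y - j)) K)) r.
    elim=> [_|j IHj lt_jy].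
      rewrite subn0; apply: IHs e0 _ => //; apply: halts_step.
      by rewrite step_retE /step_ret /= nsnd_pair.
    have [|z ez] := lt_y (y - j.+1); first by rewrite ltn_subrL (leq_trans _ lt_jy).
    apply: IHs ez _ => //; apply: halts_step.
    rewrite step_retE /step_ret /= nfst_pair nsnd_pair subnSK //.
    exact/IHj/ltnW.
  by move=> /(_ y (leqnn y)); rewrite subnn.
Qed.

Lemma frame_inv s y t p q K r :
  iter s step (ret y (push t p q K)) = ret r 0 ->
  exists2 s', s = s'.+1 & iter s' step (step_ret y t p q K) = ret r 0.
Proof.
case: s => [/push_neq0//|s]; rewrite iterSr step_retE => H.
by exists s.
Qed.

(** Induction on the number of steps rather than on the program: every recursive
    call leaves fewer steps to go, and so does every turn of a minimisation
    loop, for which no bound is known in advance. *)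
Lemma run_sound s e x K r : iter s step (run e x K) = ret r 0 ->
  exists y s', [/\ phi e x y, s' < s & iter s' step (ret y K) = ret r 0].
Proof.
elim/ltn_ind: s e x K => -[|s] IH e x K; first by move=> /run_neq_ret.
rewrite iterSr step_runE /step_run -!/(opl e) -!/(opr e) phiE.
have {}IH s' e' x' K' (le : s' <= s) := IH s' le e' x' K'.
case E: (nfst e) => [|[|[|[|[|[|[|[|[|?]]]]]]]]] //=;
  try by move=> H; do 2!eexists; split; [reflexivity| |exact: H].
- move=> /(IH _ _ _ _ (leqnn s))[u [s1 [eu lt1 /frame_inv[s2 s12]]]] /=.
  move=> /IH[|v [s3 [ev lt3 /frame_inv[s4 s34]]]]; first by lia.
  by rewrite /step_ret /= => H; exists (npair u v), s4; split; [exists u, v | lia |].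
- move=> /(IH _ _ _ _ (leqnn s))[z [s1 [ez lt1 /frame_inv[s2 s12]]]] /=.
  move=> /IH[|y [s3 [ey lt3 H]]]; first by lia.
  by exists y, s3; split; [exists z | lia |].
- have phiP y n : phi e (npair (nfst x) n) y =
      prec_graph (phi (opl e)) (phi (opr e)) (nfst x) n y.
    by rewrite phiE E nfst_pair nsnd_pair.
  case: (nsnd x) => [|n] /=.
    by move=> /(IH _ _ _ _ (leqnn s))[y [s1 [ey lt1 H]]]; exists y, s1; split=> //; lia.
  move=> /(IH _ _ _ _ (leqnn s))[z [s1 [+ lt1 /frame_inv[s2 s12]]]].
  rewrite phiP /step_ret /= nfst_pair nsnd_pair => pz.
  move=> /IH[|y [s3 [ey lt3 H]]]; first by lia.
  by exists y, s3; split; [exists z | lia |].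
- suff loop s1 i : s1 <= s ->
      iter s1 step (run (nsnd e) (npair x i) (push 4 (nsnd e) (npair x i) K))
        = ret r 0 ->
      exists y s', [/\ phi (nsnd e) (npair x y) 0,
        forall j, i <= j < y -> exists z, phi (nsnd e) (npair x j) z.+1,
        s' < s1 & iter s' step (ret y K) = ret r 0].
    move=> /(loop _ _ (leqnn s))[y [s' [e0 lt_y lt_s H]]].
    by exists y, s'; split; [split=> // i; apply: lt_y | lia |].
  elim/ltn_ind: s1 i => s1 IHs i le1 /IH[]// z [s2 [ez lt2 /frame_inv[s3 s23]]].
  rewrite /step_ret /= nfst_pair nsnd_pair.
  case: z ez => [|z] ez /= H.
    by exists i, s3; split=> //; [move=> j; lia | lia].
  have [||y [s' [e0 lt_y lt_s H']]] := IHs s3 _ i.+1 _ H; [lia | lia |].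
  exists y, s'; split=> //; last by lia.
  move=> j /andP[]; rewrite leq_eqVlt => /orP[/eqP<- _|lt_ij lt_jy].
    by exists z.
  by apply: lt_y; rewrite lt_ij.
Qed.

Definition config (e x s : nat) : nat := iter s step (run e x 0).

Lemma phi_config e x y : phi e x y <-> exists s, config e x s = ret y 0.
Proof.
split=> [exy|[s /run_sound[y' [s' [exy' _]]]]].
  by apply: run_complete exy _; exists 0.
by rewrite iter_final => /ret_inj <-.
Qed.

Definition halted (e x s : nat) : bool :=
  (nfst (nsnd (config e x s)) == 0) && (nfst (config e x s) == 0).

Definition output (e x s : nat) : nat := nsnd (nsnd (config e x s)).

Lemma haltedP e x s :
  reflect (config e x s = ret (output e x s) 0) (halted e x s).
Proof.
apply: (iffP andP) => [[/eqP t0 /eqP K0]|->]; last first.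
  by rewrite /ret !(nfst_pair, nsnd_pair).
rewrite /ret /output -{1}[config _ _ _]npair_eta K0.
by rewrite -{1}[nsnd (config _ _ _)]npair_eta t0.
Qed.

Lemma W_halted e x : W e x <-> exists s, halted e x s.
Proof.
split=> [[y /phi_config[s exs]]|[s /haltedP exs]].
  by exists s; apply/haltedP; rewrite /output exs /ret !nsnd_pair.
by exists (output e x s); apply/phi_config; exists s.
Qed.

Lemma halted_mono e x s t : s <= t -> halted e x s -> halted e x t.
Proof.
move=> /subnK<- /haltedP exs; apply/haltedP; rewrite /output /config iterD.
by rewrite -/(config _ _ _) exs iter_final /ret !nsnd_pair.
Qed.

Lemma halted0 e x : halted e x 0 = false.
Proof.
by apply/haltedP; rewrite /config /=; apply: run_neq_ret.
Qed.

Lemma computable_config A f g k :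
  computable_in A f -> computable_in A g -> computable_in A k ->
  computable_in A (fun x => config (f x) (g x) (k x)).
Proof.
move=> fP gP kP; rewrite /config /run.
apply: (computable_iter (g := fun=> step)) kP _; last by computability.
exact/computable_step/computable_snd/computable_id.
Qed.

Lemma computable_halted A f g k :
  computable_in A f -> computable_in A g -> computable_in A k ->
  computable_in A (fun x => halted (f x) (g x) (k x)).
Proof.
move=> fP gP kP; have := computable_config fP gP kP; rewrite /halted => H.
computability.
Qed.

Lemma computable_output A f g k :
  computable_in A f -> computable_in A g -> computable_in A k ->
  computable_in A (fun x => output (f x) (g x) (k x)).
Proof.
by move=> fP gP kP; do 2!apply: computable_snd; apply: computable_config.
Qed.

Ltac computability_extension ::=
  lazymatch goal with
  | |- computable_in _ (fun x => nat_of_bool (halted _ _ _)) =>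
      apply: computable_halted; computability
  | |- computable_in _ (fun x => output _ _ _) =>
      apply: computable_output; computability
  end.

(** * Universal program and recursion theorem *)

(** Kleene normal form: search for the halting time, then read the output. *)
Lemma universal : exists U, forall e x y,
  eval set0 U (npair e x) y <-> phi e x y.
Proof.
have [c cP] : computable_in set0 (fun w =>
    ~~ halted (nfst (nfst w)) (nsnd (nfst w)) (nsnd w)) by computability.
have [d dP] : computable_in set0 (fun w =>
    output (nfst (nfst w)) (nsnd (nfst w)) (nsnd w)) by computability.
exists (Comp d (Pair code_id (Mu c))) => e x y.
have {}cP s : eval set0 c (npair (npair e x) s) (~~ halted e x s).
  by have := cP (npair (npair e x) s); rewrite !(nfst_pair, nsnd_pair).
have {}dP s : eval set0 d (npair (npair e x) s) (output e x s).
  by have := dP (npair (npair e x) s); rewrite !(nfst_pair, nsnd_pair).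
split=> [[z [u [s [/(eval_functional (eval_id set0 _)) eu [es _] ->]]] ey]|exy].
  rewrite -eu {u eu} in es ey.
  apply/phi_config; exists s; rewrite (eval_functional ey (dP s)).
  by apply/haltedP; have := eval_functional es (cP s); case: (halted e x s).
have ex : exists s, halted e x s by apply/W_halted; exists y.
case: (ex_minnP ex) => s hs mins.
exists (npair (npair e x) s).
  exists (npair e x), s; split=> //; first exact: eval_id.
  split; first by have := cP s; rewrite hs.
  move=> i lt_is; exists 0; have := cP i.
  by case: (boolP (halted e x i)) => // /mins; rewrite leqNgt lt_is.
rewrite (_ : y = output e x s) //.
apply: eval_functional exy _; apply/phi_config; exists s; exact/haltedP.
Qed.

Fixpoint code_const (k : nat) : code :=
  if k is k'.+1 then Comp Succ (code_const k') else Zero.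

Lemma eval_const A k x : eval A (code_const k) x k.
Proof. by elim: k => //= k IHk; exists k. Qed.

Definition const_index (k : nat) : nat :=
  iter k (fun e => npair 6 (npair (npair 1 0) e)) (npair 0 0).

Lemma const_indexE k : const_index k = encode (code_const k).
Proof. by elim: k => //= k <-. Qed.

(** The index of the composition of the program [e] with
    [Pair (code_const p) code_id]. No decoding of [e] is involved, which makes
    [smn] visibly computable. *)
Definition smn (e p : nat) : nat :=
  npair 6 (npair e (npair 5 (npair (const_index p) (encode code_id)))).

Lemma computable_smn A f g :
  computable_in A f -> computable_in A g ->
  computable_in A (fun x => smn (f x) (g x)).
Proof.
by move=> fP gP; rewrite /smn /const_index; computability.
Qed.

Lemma smnE c p x y : phi (smn (encode c) p) x y <-> eval set0 c (npair p x) y.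
Proof.
have -> : smn (encode c) p = encode (Comp c (Pair (code_const p) code_id)).
  by rewrite /smn const_indexE.
rewrite phi_encode; apply: eval_comp.
by apply: eval_pair; [exact: eval_const | exact: eval_id].
Qed.

(** Recursion theorem with a parameter [p]: the program [e] rebuilds the index
    [smn e (npair e p)] of its own specialisation from its argument, by the
    usual diagonal. *)
Lemma recursion c : exists2 g, computable_in set0 g &
  forall p x y, phi (g p) x y <-> eval set0 c (npair (npair (g p) p) x) y.
Proof.
have [d dP] : computable_in set0 (fun w => npair
    (npair (smn (nfst (nfst w)) (nfst w)) (nsnd (nfst w))) (nsnd w)).
  by apply: computable_pair; [apply: computable_pair; [apply: computable_smn|]|];
    computability.
set e := encode (Comp c d); exists (fun p => smn e (npair e p)).
  by apply: computable_smn; computability.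
move=> p x y; rewrite smnE; apply: eval_comp.
by have := dP (npair (npair e p) x); rewrite !(nfst_pair, nsnd_pair).
Qed.

(** * Approximation of functions computable in a c.e. set *)

(** Bounded minimisation as an iteration: the state is stuck at the first
    solution. *)
Lemma iter_search (p : pred nat) y t :
  p y -> (forall i, i < y -> ~~ p i) -> y <= t ->
  iter t (fun i => if p i then i else i.+1) 0 = y.
Proof.
move=> py lt_y; have to_y j : j <= y -> iter j (fun i => if p i then i else i.+1) 0 = j.
  by elim: j => //= j IHj lt_jy; rewrite (IHj (ltnW lt_jy)) (negbTE (lt_y _ lt_jy)).
elim: t => [|t IHt]; first by rewrite leqn0 => /eqP ->.
rewrite leq_eqVlt => /orP[/eqP <-|/IHt /= ->]; first exact: to_y.
by rewrite py.
Qed.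

(** Induction on the program, with an approximation [h] that is total and a
    modulus [m] that only has to converge where the program does. For an oracle
    query [x], the modulus is a stage at which [x] has been enumerated if [x] is
    in [A], a condition that [A] can test, and 0 otherwise. In the other
    cases it is the maximum of the moduli of all the calls made, which [m] finds
    by repeating the computation with oracle [A]. *)
Lemma limit_lemma A c : ce A -> exists2 h, computable_in set0 h &
  exists m, forall x y, eval A c x y ->
    exists2 b, eval A m x b & forall t, b <= t -> h (npair x t) = y.
Proof.
move=> [a Aa].
have exact_limit h d : computable_in set0 h -> (forall x, eval A d x (h x)) ->
    exists2 h', computable_in set0 h' & exists m, forall x y, eval A d x y ->
      exists2 b, eval A m x b & forall t, b <= t -> h' (npair x t) = y.
  move=> hP dP; exists (fun w => h (nfst w)).
    by apply: (computable_comp hP); computability.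
  exists Zero => x y exy; exists 0 => // t _.
  by rewrite nfst_pair; apply: eval_functional exy.
have [cmax cmaxP] : computable_in A (fun w => maxn (nfst w) (nsnd w)).
  by computability.
have maxP d1 d2 x b1 b2 : eval A d1 x b1 -> eval A d2 x b2 ->
    eval A (Comp cmax (Pair d1 d2)) x (maxn b1 b2).
  move=> e1 e2; exists (npair b1 b2); first by exists b1, b2.
  by have := cmaxP (npair b1 b2); rewrite nfst_pair nsnd_pair.
elim: c => [||||| c [hc hcP [mc mcP]] d [hd hdP [md mdP]]
  | c [hc hcP [mc mcP]] d [hd hdP [md mdP]]
  | c [hc hcP [mc mcP]] d [hd hdP [md mdP]] | c [hc hcP [mc mcP]]].
- by apply: (exact_limit (fun=> 0)) => //; computability.
- by apply: (exact_limit succn) => //; exists Succ.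
- by apply: (exact_limit nfst) => //; exists Fst.
- by apply: (exact_limit nsnd) => //; exists Snd.
- exists (fun w => halted a (nfst w) (nsnd w)); first by computability.
  have [|x|m [cm cmP] mP] := @computable_search A
    (fun w => ~~ ((char A (nfst w) == 1) && ~~ halted a (nfst w) (nsnd w))).
  + by computability.
  + rewrite /char; case: (boolP (x \in A)) => [xA|xA]; last first.
      by exists 0; rewrite nfst_pair (negbTE xA).
    move: (xA); rewrite in_setE Aa => /W_halted[s hs].
    by exists s; rewrite nfst_pair nsnd_pair hs andbF.
  + exists cm => x _ ->; exists (m x) => // t le_t.
    have := mP x; rewrite !(nfst_pair, nsnd_pair) /char.
    case: (boolP (x \in A)) => [_ /=|xA _].
      by rewrite negbK => /(halted_mono le_t) ->.
    case: (boolP (halted a x t)) => // hx; case/negP: xA.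
    by rewrite in_setE Aa; apply/W_halted; exists t.
- exists (fun w => npair (hc w) (hd w)); first exact: computable_pair.
  exists (Comp cmax (Pair mc md)) => x y [u [v [/mcP[b1 e1 lim1] /mdP[b2 e2 lim2] ->]]].
  exists (maxn b1 b2); first exact: maxP.
  by move=> t; rewrite geq_max => /andP[/lim1 -> /lim2 ->].
- exists (fun w => hc (npair (hd w) (nsnd w))).
    by apply: (computable_comp hcP); computability.
  exists (Comp cmax (Pair md (Comp mc d))) => x y [z dz /mcP[b1 e1 lim1]].
  have [b2 e2 lim2] := mdP _ _ dz.
  exists (maxn b2 b1); first by apply: maxP => //; exists z.
  by move=> t; rewrite geq_max => /andP[/lim2 -> /lim1]; rewrite nsnd_pair.
- exists (fun w => iteri (nsnd (nfst w))
      (fun n z => hd (npair (npair (nfst (nfst w)) (npair n z)) (nsnd w)))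
      (hc (npair (nfst (nfst w)) (nsnd w)))).
    apply: (computable_iteri (g := fun w n z =>
      hd (npair (npair (nfst (nfst w)) (npair n z)) (nsnd w)))).
    + by apply: (computable_comp hdP); computability.
    + by computability.
    + by apply: (computable_comp hcP); computability.
  (* The recursion computing the modulus carries the pair of the value and the
     maximum so far; [s1] and [s2] extract from its state the argument of [d]
     and that maximum. *)
  have [s1 s1P] : computable_in A
      (fun w => npair (nfst w) (npair (nfst (nsnd w)) (nfst (nsnd (nsnd w))))).
    by computability.
  have [s2 s2P] : computable_in A (fun w => nsnd (nsnd (nsnd w))).
    by computability.
  exists (Comp Snd (Prec (Pair c mc)
    (Pair (Comp d s1) (Comp cmax (Pair s2 (Comp md s1)))))) => x y cdy.
  suff [b pb lim] : exists2 b, prec_graph (eval A (Pair c mc))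
      (eval A (Pair (Comp d s1) (Comp cmax (Pair s2 (Comp md s1)))))
      (nfst x) (nsnd x) (npair y b) &
      forall t, b <= t -> iteri (nsnd x)
        (fun n z => hd (npair (npair (nfst x) (npair n z)) t))
        (hc (npair (nfst x) t)) = y.
    exists b; first by exists (npair y b); rewrite //= nsnd_pair.
    by move=> t /lim; rewrite !(nfst_pair, nsnd_pair).
  move: cdy; rewrite !eval_prec.
  elim: (nsnd x) y => [|n IHn] y.
    by move=> cy; have [b eb lim] := mcP _ _ cy; exists b => //; exact: (eval_pair cy eb).
  move=> [z /IHn[b pb limb] dy]; have [b' eb' limb'] := mdP _ _ dy.
  have := s1P (npair (nfst x) (npair n (npair z b))).
  have := s2P (npair (nfst x) (npair n (npair z b))).
  rewrite !(nfst_pair, nsnd_pair) => e2 e1.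
  exists (maxn b b').
    exists (npair z b) => //; apply: eval_pair; first exact/(eval_comp _ _ e1).
    by apply: maxP => //; apply/(eval_comp _ _ e1).
  by move=> t; rewrite geq_max => /andP[/limb /= -> /limb' ->].
- (* Only candidates below the stage are tried; the modulus of a computation
     with value [y] therefore also exceeds [y]. *)
  exists (fun w => iter (nsnd w) (fun i =>
      if hc (npair (npair (nfst w) i) (nsnd w)) == 0 then i else i.+1) 0).
    apply: (computable_iter (g := fun w i =>
      if hc (npair (npair (nfst w) i) (nsnd w)) == 0 then i else i.+1));
      by computability.
  have [s1 s1P] : computable_in A (fun w => npair (nfst w) (nfst (nsnd w))).
    by computability.
  have [s2 s2P] : computable_in A
    (fun w => maxn (nsnd (nsnd w)) (nfst (nsnd w)).+1) by computability.
  set step := Comp cmax (Pair s2 (Comp mc s1)).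
  exists (Comp (Prec Zero step) (Pair code_id (Comp Succ (Mu c)))).
  move=> x y [cy lt_y].
  have bounds n : (forall i, i < n -> exists z, eval A c (npair x i) z) ->
      exists b, [/\ prec_graph (eval A Zero) (eval A step) x n b, n <= b &
        forall i z, i < n -> eval A c (npair x i) z ->
          forall t, b <= t -> hc (npair (npair x i) t) = z].
    elim: n => [_|n IHn conv]; first by exists 0.
    have [|b [pb le_nb lim]] := IHn.
      by move=> i lt_in; apply: conv; apply: ltnW.
    have [z cz] := conv n (ltnSn n); have [b' eb' lim'] := mcP _ _ cz.
    have := s1P (npair x (npair n b)); have := s2P (npair x (npair n b)).
    rewrite !(nfst_pair, nsnd_pair) => e2 e1.
    exists (maxn (maxn b n.+1) b'); split.
    + by exists b => //; apply: maxP => //; apply/(eval_comp _ _ e1).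
    + by rewrite !leq_max leqnn orbT.
    + move=> i z'; rewrite ltnS leq_eqVlt => /orP[/eqP->|lt_in] cz' t;
        rewrite !geq_max -andbA => /and3P[le1 le2 le3].
        by rewrite (eval_functional cz' cz); apply: lim'.
      exact: lim cz' _ le1.
  have [|b [pb lt_yb lim]] := bounds y.+1.
    move=> i; rewrite ltnS leq_eqVlt => /orP[/eqP->|/lt_y[z cz]].
      by exists 0.
    by exists z.+1.
  exists b.
    have ey : eval A (Pair code_id (Comp Succ (Mu c))) x (npair x y.+1).
      by apply: eval_pair; [exact: eval_id | exists y].
    by apply/(eval_comp _ _ ey); rewrite eval_prec nfst_pair nsnd_pair.
  move=> t le_bt; rewrite !(nfst_pair, nsnd_pair).
  apply: iter_search; first by rewrite (lim y 0).
    by move=> i lt_iy; have [z /lim->] := lt_y _ lt_iy => //; apply: ltnW.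
  exact: leq_trans (ltnW lt_yb) le_bt.
Qed.

(** * From Skolem functions to reductions *)

(** Exactly one of 0 and 1 is in [W (f n)], so the search for a halting computation
    on one of them is total and its outcome decides [n \in A]. *)
Lemma skolem_turing_le A B (S : Type) (gamma : nat -> S) :
  (forall n m, gamma n = gamma m -> W n = W m) ->
  Skolem A B gamma -> turing_le A B.
Proof.
move=> gammaW sk.
have [d dP] : computable_in set0 (fun w => nfst w == 0) by computability.
pose a := encode (Mu Fst); pose b := encode (Mu (Comp d Fst)).
have Wa0 : W a 0.
  by exists 0; rewrite phi_encode /=; split=> //; rewrite nfst_pair.
have Wa1 : ~ W a 1.
  by move=> [y]; rewrite phi_encode /= nfst_pair => -[].
have Wb0 : ~ W b 0.
  move=> [y]; rewrite phi_encode => -[[z ->]]; rewrite nfst_pair.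
  by move=> /(eval_functional (dP 0)).
have Wb1 : W b 1.
  exists 0; rewrite phi_encode; split=> //.
  exists 1; first by rewrite /= nfst_pair.
  by have := dP (npair 1 0); rewrite nfst_pair.
have [|f fP fixf] := sk (fun n _ => if char A n == 1 then a else b).
  have [c cP] : computable_in A (fun w => if char A (nfst w) == 1 then a else b).
    by computability.
  by exists c => x y; have := cP (npair x y); rewrite nfst_pair.
have Wf n : W (f n) = if n \in A then W a else W b.
  by have /gammaW <- := fixf n; rewrite /char; case: (n \in A).
have [||g gP halts_g] := @computable_search B (fun v =>
    ~~ (~~ halted (f (nfst v)) 0 (nsnd v) && ~~ halted (f (nfst v)) 1 (nsnd v))).
- by computability.
- move=> n; suff [s hs] : exists s, halted (f n) 0 s || halted (f n) 1 s.
    by exists s; rewrite nfst_pair nsnd_pair negb_and !negbK.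
  move: (Wf n); case: (n \in A) => Wfn.
    by have /W_halted[s hs] : W (f n) 0; [rewrite Wfn | exists s; rewrite hs].
  by have /W_halted[s hs] : W (f n) 1; [rewrite Wfn | exists s; rewrite hs orbT].
apply: computable_ext (_ : computable_in B (fun n => halted (f n) 0 (g n))); last first.
  by computability.
move=> n; have := halts_g n.
rewrite nfst_pair nsnd_pair negb_and !negbK /char.
move: (Wf n); case: (n \in A) => Wfn.
  case/orP=> [->//|h1]; case: Wa1; rewrite -Wfn; apply/W_halted; by exists (g n).
case: (boolP (halted (f n) 0 (g n))) => // h0 _.
by case: Wb0; rewrite -Wfn; apply/W_halted; exists (g n).
Qed.

(** * Fixed points below an incomplete c.e. set *)

(** Stating the entry of [k] into the halting problem as a change between two
    consecutive stages makes the stage unique: nothing has halted at stage 0,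
    and halting is monotone. *)
Definition enters (k s : nat) : bool := ~~ halted k k s && halted k k s.+1.

Lemma enters_inj k s t : enters k s -> enters k t -> s = t.
Proof.
move=> /andP[ns hs] /andP[nt ht].
case: (ltngtP s t) => // lt; [case/negP: nt|case/negP: ns];
  exact: halted_mono lt _.
Qed.

Lemma enters_after k b :
  zero_jump k -> ~~ halted k k b -> exists2 s, b <= s & enters k s.
Proof.
move=> /W_halted ex nb.
case: (ex_minnP ex) => -[|s] hs mins; first by rewrite halted0 in hs.
exists s; last by rewrite /enters hs andbT; apply/negP => /mins; rewrite ltnn.
by rewrite leqNgt; apply: contra nb => lt; apply: halted_mono lt hs.
Qed.

Lemma computable_enters A f g : computable_in A f -> computable_in A g ->
  computable_in A (fun x => enters (f x) (g x)).
Proof. by move=> fP gP; rewrite /enters; computability. Qed.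

(** The recursion theorem applied to the program that waits for the stage [s] at
    which [k] enters the halting problem and then runs the program with index
    [hh (npair (npair n e) s)], where [e] is its own index. *)
Lemma delayed_fixpoint hh : computable_in set0 hh ->
  exists2 g, computable_in set0 g & forall n k s, enters k s ->
    phi (g (npair n k)) = phi (hh (npair (npair n (g (npair n k))) s)).
Proof.
move=> hhP; have [U UP] := universal.
have [st stP] : computable_in set0 (fun v =>
    ~~ enters (nsnd (nsnd (nfst (nfst v)))) (nsnd v)).
  by apply: computable_negb; apply: computable_enters; computability.
have [arg argP] : computable_in set0 (fun v => npair
    (hh (npair (npair (nfst (nsnd (nfst (nfst v)))) (nfst (nfst (nfst v))))
               (nsnd v)))
    (nsnd (nfst v))) by computability.
have [g gP gE] := recursion (Comp U (Comp arg (Pair code_id (Mu st)))).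
exists g => // n k s ent; set e := g _.
apply/funext => x; apply/funext => y; apply/propext.
rewrite gE -/e -UP; set w := npair _ x.
have {}stP t : eval set0 st (npair w t) (~~ enters k t).
  by have := stP (npair w t); rewrite /w !(nfst_pair, nsnd_pair).
have ws : eval set0 (Mu st) w s.
  split; first by have := stP s; rewrite ent.
  move=> t lt_ts; exists 0; have := stP t; case: (boolP (enters k t)) => // ent'.
  by move: lt_ts; rewrite (enters_inj ent' ent) ltnn.
apply: eval_comp; apply/(eval_comp _ _ (eval_pair (eval_id _ _) ws)).
by have := argP (npair w s); rewrite /w !(nfst_pair, nsnd_pair).
Qed.

(** The search for [k] compares [hh] with [h] instead of calling the modulus;
    the modulus only shows that the search succeeds. *)
Lemma arslanov A h : ce A -> incomplete A -> computable2_in A h ->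
  exists2 f, computable_in A f & forall n, phi (h n (f n)) = phi (f n).
Proof.
move=> ceA incA [c cP].
have hP : computable_in A (fun w => h (nfst w) (nsnd w)).
  by exists c => w; rewrite -{1}[w]npair_eta.
have [hh hhP [m mP]] := limit_lemma c ceA.
have [g /(computable_in0 A) gP gE] := delayed_fixpoint hhP.
have {}hhP := computable_in0 A hhP.
pose good n k s := enters k s &&
  (hh (npair (npair n (g (npair n k))) s) == h n (g (npair n k))).
have [||f fP f_good] := @computable_search A (fun v =>
    good (nfst v) (nfst (nsnd v)) (nsnd (nsnd v))).
- have hgP : computable_in A (fun v =>
      h (nfst v) (g (npair (nfst v) (nfst (nsnd v))))).
    apply: computable_ext
      (computable_comp hP (_ : computable_in A (fun v =>
         npair (nfst v) (g (npair (nfst v) (nfst (nsnd v))))))).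
      by move=> v; rewrite nfst_pair nsnd_pair.
    by computability.
  apply: computable_andb; last by computability.
  by apply: computable_enters; computability.
- move=> n; apply: contrapT => none; apply: incA.
  have [d dP] : computable_in A (fun k => npair n (g (npair n k))).
    by computability.
  have /choice[b /all_and2[bP lim]] k : exists b,
      eval A m (npair n (g (npair n k))) b /\ forall t, b <= t ->
        hh (npair (npair n (g (npair n k))) t) = h n (g (npair n k)).
    by have [b eb lim] := mP _ _ (cP n (g (npair n k))); exists b.
  have {d dP}bP : computable_in A b.
    by exists (Comp m d) => k; apply/(eval_comp _ _ (dP k)).
  apply: computable_ext (_ : computable_in A (fun k => halted k k (b k)));
    last by computability.
  move=> k; rewrite /char; congr nat_of_bool; apply/idP/idP => [hk|].
    by rewrite in_setE; apply/W_halted; exists (b k).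
  rewrite in_setE => jk; apply: contraT => /(enters_after jk)[s le_bs ent].
  case: none; exists (npair k s).
  by rewrite /good !(nfst_pair, nsnd_pair) ent lim /=.
exists (fun n => g (npair n (nfst (f n)))); first by computability.
move=> n; have := f_good n; rewrite !(nfst_pair, nsnd_pair).
by move=> /andP[/gE -> /eqP ->].
Qed.

Theorem corollary4p5 (A B : set nat) :
  ce A -> incomplete A ->
  (Skolem A B W <-> turing_le A B) /\ (Skolem A B phi <-> turing_le A B).
Proof.
move=> ceA incA.
have phiW n m : phi n = phi m -> W n = W m by move=> e; rewrite /W e.
have skolem_phi : turing_le A B -> Skolem A B phi.
  move=> leAB h /(arslanov ceA incA)[f fP fixf]; exists f => //.
  exact: computable_in_trans fP.
split; split.
- by apply: skolem_turing_le.
- move=> /skolem_phi sk h /sk[f fP fixf]; exists f => // n.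
  exact/phiW/fixf.
- by apply: skolem_turing_le.
- exact: skolem_phi.
Qed.
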